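(* Let $X$ be a Banach space. If every separable (closed) subspace of $X$ has summable Szlenk index, then $X$ has summable Szlenk index.
   Context: For a weak$^\ast$-compact subset $K$ of the dual $X^\ast$ of a Banach space $X$ and $\varepsilon>0$, the $\varepsilon$-Szlenk derivation is $$\iota_\varepsilon K=\{x^\ast\in K:\ \mathrm{diam}(K\cap U)>\varepsilon\text{ for every }w^\ast\text{-open neighborhood }U\text{ of }x^\ast\}.$$ $\iota_{\varepsilon_1}\ldots\iota_{\varepsilon_n}K$ denotes the composition $\iota_{\varepsilon_1}(\iota_{\varepsilon_2}(\cdots\iota_{\varepsilon_n}(K)\cdots))$. With $B_{X^\ast}$ the closed unit ball of $X^\ast$, the space $X$ has summable Szlenk index if there is a constant $M$ such that for all $n\in\mathbb{N}$ and all $\varepsilon_1,\ldots,\varepsilon_n>0$ one has $\sum_{i=1}^n\varepsilon_i\leq M$ whenever $\iota_{\varepsilon_1}\ldots\iota_{\varepsilon_n}B_{X^\ast}\neq\varnothing$. *)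

(* Defs.v *)
From HB Require Import structures.
From mathcomp Require Import all_boot all_order all_algebra.
From mathcomp Require Import all_classical all_reals all_analysis.

Set Implicit Arguments.
Unset Strict Implicit.
Unset Printing Implicit Defensive.

Import Order.TTheory GRing.Theory Num.Theory.
Import numFieldNormedType.Exports.

Local Open Scope classical_set_scope.
Local Open Scope ring_scope.

Section Dual.
Context (R : realType) (X : normedModType R).

(* The topological dual, as a set of functions on X.  Coerced to a type it
   carries the initial topology for its inclusion into {ptws X -> R}, that is,
   the weak* topology: [open (U : set (dual X))] means "U is w*-open". *)
Definition dual : set {ptws X -> R^o} :=
  [set f | linear (f : X -> R^o) /\ continuous (f : X -> R^o)].

(* Extended-real valued because it is defined on arbitrary functions; on the
   dual it is the usual (finite) dual norm. *)
Definition op_norm (f : X -> R) : \bar R :=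
  ereal_sup [set `|f x|%:E | x in [set x | `|x| <= 1]].

Definition dual_ball : set dual := [set f | (op_norm (\val f) <= 1)%E].

Definition dual_diam (A : set dual) : \bar R :=
  ereal_sup [set op_norm (\val fg.1 \- \val fg.2) | fg in A `*` A].

Definition szlenk_deriv (eps : R) (K : set dual) : set dual :=
  [set f | K f /\
    forall U : set dual, open U -> U f -> (eps%:E < dual_diam (K `&` U))%E].

(* The head of the list is applied last. *)
Definition szlenk_derivs (eps : seq R) (K : set dual) : set dual :=
  foldr szlenk_deriv K eps.

End Dual.

Arguments dual {R} X _.
Arguments dual_ball {R} X _.

(* Stated for any normed space, so that it applies to the type of vectors of a
   closed subspace without an instance of completeness for that type. *)
Definition summable_szlenk (R : realType) (X : normedModType R) : Prop :=
  exists M : R, forall (n : nat) (eps : n.-tuple R),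
    (forall i, 0 < tnth eps i) ->
    szlenk_derivs eps (dual_ball X) !=set0 ->
    \sum_(i < n) tnth eps i <= M.

Section Submodule.
Context (R : realType) (X : normedModType R) (Y : submodClosed X).

(* Y with the restricted vector space operations and the restricted norm. *)
Definition submodule : Type := {x : X | x \in Y}.

HB.instance Definition _ := SubChoice.on submodule.
HB.instance Definition _ := [SubChoice_isSubLmodule of submodule by <:].

Let norm (y : submodule) : R := `|\val y|.

Let ler_normD (x y : submodule) : norm (x + y) <= norm x + norm y.
Proof. by rewrite /norm raddfD /= ler_normD. Qed.

Let normrZ (a : R) (x : submodule) : norm (a *: x) = `|a| * norm x.
Proof. by rewrite /norm linearZ /= normrZ. Qed.

Let normr0_eq0 (x : submodule) : norm x = 0 -> x = 0.
Proof. by move=> /normr0_eq0 x0; apply/val_inj; rewrite x0 raddf0. Qed.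

HB.instance Definition _ :=
  Lmodule_isNormed.Build R submodule ler_normD normrZ normr0_eq0.

End Submodule.

Definition separable (T : topologicalType) : Prop :=
  exists2 A : set T, countable A & dense A.

(* Main.v *)
Require Import Defs.
From HB Require Import structures.
From mathcomp Require Import all_boot all_order all_algebra.
From mathcomp Require Import all_classical all_reals all_analysis.
From mathcomp Require Import ring.

Set Implicit Arguments.
Unset Strict Implicit.
Unset Printing Implicit Defensive.

Import Order.TTheory GRing.Theory Num.Theory.
Import numFieldNormedType.Exports.

Local Open Scope classical_set_scope.
Local Open Scope ring_scope.

(* Non-emptiness of an iterated derivation of the dual ball is witnessed
   countably, by a Lowenheim-Skolem argument.  If f lies in the eps-derivation
   of K, then for any finitely many points there are g, h in K close to f at
   these points, and a point x of the unit ball with |g x - h x| > eps.  If the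
   index of X is not summable, choose for every k a tuple of sum > k and an
   element of the corresponding derived set, and close up under rational
   combinations of points and under the choice of g, h, x.  This gives a
   countable set D of points whose closure is a separable subspace Y.  On the
   dual ball of Y, evaluations at D generate the weak* topology, so all chosen
   functionals restrict to elements of the corresponding derived sets of Y,
   with the same tuples. *)

(** * Countable Skolem hulls *)

(* Skolem terms, the leaves being the base points and the labels of the nodes
   encoding the function symbols: there are countably many of them. *)
Fixpoint tree_eval (W I : Type) (F : I * seq W -> W) (w0 : nat -> W)
    (dec : nat -> option I) (t : GenTree.tree nat) : W :=
  match t with
  | GenTree.Leaf n => w0 n
  | GenTree.Node k l =>
    if dec k is Some i then F (i, map (tree_eval F w0 dec) l) else w0 0%N
  end.

(** Fix one choice function [F] for [P]. A list of values of terms, fed to [F] with an index, gives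
    the value of the node whose children are these terms, so the countable set of all values is
    closed under [F]. *)
Lemma skolem_hull (W : choiceType) (I : countType)
    (P : I -> seq W -> W -> Prop) (w0 : nat -> W) :
  exists2 C : set W, countable C &
    (forall n, C (w0 n)) /\
    forall i s, (forall w, w \in s -> C w) -> (exists w, P i s w) ->
      exists2 w, C w & P i s w.
Proof.
have /choice[F PF] (p : I * seq W) :
    exists w, (exists v, P p.1 p.2 v) -> P p.1 p.2 w.
  case: p => i s /=.
  have [[w Pw]|nP] := pselect (exists w, P i s w); first by exists w.
  by exists (w0 0%N) => /nP.
pose ev := tree_eval F w0 (@unpickle I).
exists (range ev); first exact/(sub_countable (card_image_le _ _))/countableP.
split=> [n|i s sC Pis]; first by exists (GenTree.Leaf n).
have [l ls] : exists l, map ev l = s.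
  elim: s sC {Pis} => [|w s IHs] sC; first by exists [::].
  have [t _ tw] := sC w (mem_head _ _).
  have [|l ls] := IHs; first by move=> v vs; apply: sC; rewrite inE vs orbT.
  by exists (t :: l); rewrite /= tw ls.
exists (F (i, s)); last exact: PF (i, s) Pis.
by exists (GenTree.Node (pickle i) l) => //; rewrite /ev /= pickleK -ls.
Qed.

(** * Functionals and the weak* topology on the dual ball *)

Section DualFacts.
Context (R : realType) (X : normedModType R).
Implicit Types f g : dual X.

Lemma dual_linear f : linear (\val f : X -> R^o).
Proof. by have /set_mem[] := valP f. Qed.

Lemma dual_continuous f : continuous (\val f : X -> R^o).
Proof. by have /set_mem[] := valP f. Qed.

Lemma dualB f x y : \val f (x - y) = \val f x - \val f y.
Proof. by rewrite addrC -scaleN1r dual_linear scaleN1r addrC. Qed.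

Lemma dual0 f : \val f 0 = 0.
Proof. by rewrite -[X in \val f X](subrr 0) dualB subrr. Qed.

Lemma dualZ f (c : R) x : \val f (c *: x) = c * \val f x.
Proof. by rewrite -[X in \val f X]addr0 dual_linear dual0 addr0. Qed.

Lemma dual_ball_le f : dual_ball X f -> forall x, `|\val f x| <= `|x|.
Proof.
move=> fB x; have [->|x0] := eqVneq x 0; first by rewrite dual0 !normr0.
have nx0 : 0 < `|x| by rewrite normr_gt0.
have : (`|\val f (`|x|^-1 *: x)|%:E <= 1)%E.
  apply: le_trans fB; apply: ereal_sup_ubound; exists (`|x|^-1 *: x) => //=.
  by rewrite normrZ normfV normr_id mulVf ?gt_eqF.
rewrite lee_fin dualZ normrM normfV normr_id mulrC.
by rewrite ler_pdivrMr// mul1r.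
Qed.

Lemma eval_continuous (x : X) : continuous (fun g => \val g x : R^o).
Proof.
move=> f; apply: (@continuous_comp _ _ _ (\val : dual X -> {ptws X -> R^o})
  (fun h : {ptws X -> R^o} => h x)); first exact: initial_continuous.
exact: proj_continuous.
Qed.

Lemma near_dual f (s : seq X) (d : R) : 0 < d ->
  \forall g \near f, forall a, a \in s -> `|\val g a - \val f a| < d.
Proof.
move=> d0; elim: s => [|x s IHs]; first by apply: (@filterE _ (nbhs f)) => g a.
have /cvgrPdist_lt/(_ d d0) fx := @eval_continuous x f.
apply: filterS2 fx IHs => g gx gs a; rewrite inE => /orP[/eqP->|/gs//].
by rewrite distrC.
Qed.

Lemma dense_ball (T : normedModType R) (D : set T) (x : T) (d : R) :
  dense D -> 0 < d -> exists2 a, D a & `|x - a| < d.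
Proof.
move=> dD d0; have [|a [xa Da]] := dD (ball x d) _ (ball_open x d).
  by exists x; exact: ballxx.
by exists a => //; move: xa; rewrite -ball_normE.
Qed.

(* On the unit ball the functionals are equi-Lipschitz, so that a dense set of
   points of evaluation generates the weak* topology there. *)
Lemma dense_nbhs_dual_ball (D : set X) f (U : set (dual X)) :
  dense D -> dual_ball X f -> nbhs f U ->
  exists s : seq X, exists2 d : R, 0 < d &
    (forall a, a \in s -> D a) /\
    forall g, dual_ball X g ->
      (forall a, a \in s -> `|\val g a - \val f a| < d) -> U g.
Proof.
move=> dD fB.
(* The sets [U] that satisfy the conclusion form a filter, so the claim becomes convergence of this
   filter to [f]. *)
pose F : set_system (dual X) :=
  [set V | exists s : seq X, exists2 d : R, 0 < d &
    (forall a, a \in s -> D a) /\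
    forall g, dual_ball X g ->
      (forall a, a \in s -> `|\val g a - \val f a| < d) -> V g].
have FF : Filter F.
  split.
  - by exists [::]; exists 1.
  - move=> V W [s [d d0 [sD sV]]] [t [e e0 [tD tW]]].
    exists (s ++ t); exists (Num.min d e); first by rewrite lt_min d0.
    split=> [a|g gB gf]; first by rewrite mem_cat => /orP[/sD|/tD].
    split; [apply: sV|apply: tW] => // a ai; have := gf a.
      by rewrite mem_cat ai lt_min => /(_ isT)/andP[].
    by rewrite mem_cat ai orbT lt_min => /(_ isT)/andP[].
  - move=> V W VW [s [d d0 [sD sV]]]; exists s; exists d => //.
    by split=> // g gB gf; exact/VW/sV.
suff Ff : F --> f by move=> /Ff.
(* Replace [x] by a point [a] of [D] within [e / 3]: both functionals are 1-Lipschitz, so each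
   changes by less than [e / 3]. *)
have Feval x : (\val g x : R^o) @[g --> F] --> (\val f x : R^o).
  apply/cvgrPdist_lt => e e0; have e3 : 0 < e / 3 by rewrite divr_gt0.
  have [a Da xa] := dense_ball x dD e3.
  exists [:: a]; exists (e / 3) => //; split=> [b|g gB].
    by rewrite inE => /eqP->.
  move=> /(_ a (mem_head _ _)) ga.
  have := dual_ball_le gB (x - a); have := dual_ball_le fB (x - a).
  rewrite !dualB => fxa gxa.
  have -> : \val f x - \val g x = (\val f x - \val f a) - (\val g a - \val f a)
    - (\val g x - \val g a) by ring.
  apply: le_lt_trans (ler_normB _ _) _.
  apply: le_lt_trans (lerD (ler_normB _ _) (lexx _)) _.
  have -> : e = e / 3 + e / 3 + e / 3 by field.
  by rewrite !ltrD// (le_lt_trans _ xa).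
(* The pointwise topology is the supremum of those induced by the evaluations, so [Feval]
   suffices. *)
have Fval : \val @ F --> (\val f : {ptws X -> R^o}).
  apply/cvg_sup => x V /= [_ [[B Bop <-] Bfx] BV].
  have /Feval : nbhs (\val f x : R^o) B by apply: open_nbhs_nbhs.
  by move=> FB; apply: (@filterS _ F _ _ _ _ FB) => g; exact: BV.
move=> V /= [_ [[B Bop <-] Bf] BV].
have /Fval : nbhs (\val f : {ptws X -> R^o}) B by apply: open_nbhs_nbhs.
by move=> FB; apply: (@filterS _ F _ _ _ _ FB) => g; exact: BV.
Qed.

Lemma szlenk_derivs_ball l : szlenk_derivs l (dual_ball X) `<=` dual_ball X.
Proof. by elim: l => [//|e l IHl] f [/IHl]. Qed.

Lemma szlenk_deriv_witness e (K : set (dual X)) f (s : seq X) (d : R) :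
  0 < d -> szlenk_deriv e K f ->
  exists (g h : dual X) (x : X),
    [/\ K g /\ K h, forall a, a \in s -> `|\val g a - \val f a| < d,
        forall a, a \in s -> `|\val h a - \val f a| < d, `|x| <= 1 &
        e < `|\val g x - \val h x|].
Proof.
move=> d0 [Kf] /(_ _ (open_interior _) (near_dual f s d0)).
move=> /ereal_sup_gt[_ [[g h] /= [[Kg gf] [Kh hf]] <-]].
move=> /ereal_sup_gt[_ [x /= x1 <-]]; rewrite lte_fin => ex.
exists g, h, x; split=> //; first exact: interior_subset gf.
exact: interior_subset hf.
Qed.

(** A converse of [szlenk_deriv_witness]. Test points in [D] suffice because [K] lies in the dual
    ball, where they determine the neighbourhoods of [f]. *)
Lemma szlenk_derivP (D : set X) e (K : set (dual X)) f :
  dense D -> K `<=` dual_ball X -> K f ->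
  (forall (s : seq X) (d : R), (forall a, a \in s -> D a) -> 0 < d ->
    exists (g h : dual X) (x : X),
      [/\ K g /\ K h, forall a, a \in s -> `|\val g a - \val f a| < d,
          forall a, a \in s -> `|\val h a - \val f a| < d, `|x| <= 1 &
          e < `|\val g x - \val h x|]) ->
  szlenk_deriv e K f.
Proof.
move=> dD KB Kf wit; split=> // U oU Uf.
have [s [d d0 [sD sU]]] :=
  dense_nbhs_dual_ball dD (KB f Kf) (open_nbhs_nbhs (conj oU Uf)).
have [g [h [x [[Kg Kh] gf hf x1 ex]]]] := wit s d sD d0.
apply: (@lt_le_trans _ _ `|\val g x - \val h x|%:E); first by rewrite lte_fin.
apply: (@le_trans _ _ (op_norm (\val g \- \val h))); apply: ereal_sup_ubound.
  by exists x.
by exists (g, h) => //; split; split=> //=; apply: sU => //; apply: KB.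
Qed.

End DualFacts.

(** * Closures of sets stable under rational combinations *)

Lemma closure_normP (R : realType) (X : normedModType R) (D : set X) (x : X) :
  closure D x <-> forall e : R, 0 < e -> exists2 a, D a & `|x - a| < e.
Proof.
split=> [Dx e e0|Dx B /nbhs_ballP[e /= e0 eB]].
  have [a [Da xa]] := Dx _ (nbhsx_ballx x e e0).
  by exists a => //; move: xa; rewrite -ball_normE.
have [a Da xa] := Dx e e0.
by exists a; split => //; apply: eB; rewrite -ball_normE.
Qed.

Section RationalClosure.
Context (R : realType) (X : normedModType R) (D : set X).
Context (D0 : D 0)
  (Dlin : forall (q : rat) u v, D u -> D v -> D (ratr q *: u + v)).

Lemma closure_submod : GRing.submod_closed [pred x : X | `[< closure D x >]].
Proof.
split=> [|c u v]; rewrite -!topredE /=.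
  by apply/asboolP; exact: subset_closure.
move=> /asboolP/closure_normP Du /asboolP/closure_normP Dv.
apply/asboolP/closure_normP => e e0.
have e3 : 0 < e / 3 by rewrite divr_gt0.
have [b Db vb] := Dv _ e3.
(* The point [a] is chosen before the rational [q], since the admissible error [c - q] depends on
   the norm of [a]. Adding 1 to the norms keeps the divisors positive. *)
have c0 : 0 < `|c| + 1 by rewrite ltr_wpDl.
have [a Da ua] := Du (e / 3 / (`|c| + 1)) (divr_gt0 e3 c0).
have a0 : 0 < `|a| + 1 by rewrite ltr_wpDl.
have d0 : 0 < e / 3 / (`|a| + 1) by rewrite divr_gt0.
have [|q] := @rat_in_itvoo _ (c - e / 3 / (`|a| + 1)) c; first by rewrite gtrBl.
rewrite in_itv /= ltrBlDl -ltrBlDr => /andP[cq qc].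
exists (ratr q *: a + b); first exact: Dlin.
have -> : c *: u + v - (ratr q *: a + b)
    = c *: (u - a) + (c - ratr q) *: a + (v - b).
  by rewrite opprD addrACA scalerBr scalerBl (addrA _ (c *: a)) subrK.
have -> : e = e / 3 + e / 3 + e / 3 by field.
apply: le_lt_trans (ler_normD _ _) _; rewrite ler_ltD //.
apply: le_trans (ler_normD _ _) _; rewrite !normrZ lerD //.
  apply: (@le_trans _ _ ((`|c| + 1) * `|u - a|)).
    by rewrite ler_wpM2r// lerDl.
  by rewrite mulrC -ler_pdivlMr// ltW.
have qc0 : 0 <= c - ratr q by rewrite subr_ge0 ltW.
rewrite ger0_norm//.
apply: (@le_trans _ _ ((c - ratr q) * (`|a| + 1))).
  by rewrite ler_wpM2l// lerDl.
by rewrite -ler_pdivlMr// ltW.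
Qed.

Lemma closure_submodClosed :
  exists Y : submodClosed X, forall x : X, (x \in Y) = `[< closure D x >].
Proof.
pose P : {pred X} := [pred x : X | `[< closure D x >]].
pose Y : submodClosed X :=
  HB.pack P (GRing.isSubmodClosed.Build R X P closure_submod).
by exists Y.
Qed.

End RationalClosure.

(** * Restriction of functionals to a subspace *)

Section Submodule.
Context (R : realType) (X : normedModType R) (Y : submodClosed X).

Lemma submodule_dense (D : set X) :
  (forall x, x \in Y -> closure D x) -> (forall x, D x -> x \in Y) ->
  dense [set y : submodule Y | D (\val y)].
Proof.
move=> YD DY O [y Oy] oO.
have /nbhs_ballP[e /= e0 eO] : nbhs y O by apply: open_nbhs_nbhs.
have [a Da ya] := (closure_normP _ _).1 (YD _ (valP y)) e e0.
exists (Sub a (DY a Da)); split=> //.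
by apply: eO; rewrite -ball_normE /=.
Qed.

Lemma submodule_separable (D : set X) : countable D ->
  (forall x, x \in Y -> closure D x) -> (forall x, D x -> x \in Y) ->
  separable (submodule Y).
Proof.
move=> cD YD DY; exists [set y : submodule Y | D (\val y)].
  have /countable_injP[h hinj] := cD; apply/countable_injP.
  exists (h \o \val) => y z; rewrite !inE => Dy Dz /= hyz.
  by apply: val_inj; apply: hinj; rewrite ?inE.
exact: submodule_dense.
Qed.

Lemma restr_dual_proof (f : dual X) :
  ((\val f : X -> R^o) \o \val : submodule Y -> R^o) \in dual (submodule Y).
Proof.
rewrite inE; split=> [c u v|y] /=.
  exact: (dual_linear f c (\val u) (\val v)).
move=> V /(@dual_continuous _ _ f (\val y))/nbhs_ballP[d /= d0 dV].
apply/nbhs_ballP; exists d => // z; rewrite -ball_normE /= => yz.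
by apply: dV; rewrite -ball_normE.
Qed.

Definition restr_dual (f : dual X) : dual (submodule Y) :=
  SigSub (restr_dual_proof f).

Lemma restr_dual_ball (f : dual X) :
  dual_ball X f -> dual_ball (submodule Y) (restr_dual f).
Proof.
move=> fB; apply: ge_ereal_sup => _ [y /= y1 <-].
by rewrite lee_fin (le_trans (dual_ball_le fB _)).
Qed.

End Submodule.

(** Induction on the tuple: witnesses stay in [T], and their separating point lies in [D], hence in
    [Y], so the separation survives restriction. The set [S] limits the demand for witnesses to the
    tuples that occur, which will be tails of countably many chosen ones. *)
Lemma restr_szlenk_derivs (R : realType) (X : normedModType R)
    (Y : submodClosed X) (D : set X) (T : set (dual X)) (S : set (seq R)) :
  (forall x, x \in Y -> closure D x) -> (forall x, D x -> x \in Y) ->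
  (forall e l, S (e :: l) -> S l) ->
  (forall e l f (s : seq X) (d : R), S (e :: l) -> T f ->
    szlenk_derivs (e :: l) (dual_ball X) f -> (forall a, a \in s -> D a) ->
    0 < d -> exists (g h : dual X) (x : X),
      [/\ [/\ T g, T h & D x],
        szlenk_derivs l (dual_ball X) g /\ szlenk_derivs l (dual_ball X) h,
        forall a, a \in s -> `|\val g a - \val f a| < d,
        forall a, a \in s -> `|\val h a - \val f a| < d &
        `|x| <= 1 /\ e < `|\val g x - \val h x|]) ->
  forall l f, S l -> T f -> szlenk_derivs l (dual_ball X) f ->
    szlenk_derivs l (dual_ball (submodule Y)) (restr_dual Y f).
Proof.
move=> YD DY Stl wit; elim=> [|e l IHl] f Sl Tf Kf.
  exact: restr_dual_ball.
have IHf g := IHl g (Stl _ _ Sl).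
apply: (szlenk_derivP (submodule_dense YD DY)).
- exact: szlenk_derivs_ball.
- by case: Kf => Kf _; exact: IHf.
move=> s d sD d0.
have [|g [h [x [[Tg Th Dx] [Kg Kh] gf hf [x1 ex]]]]] :=
  wit e l f (map \val s) d Sl Tf Kf _ d0.
  by move=> _ /mapP[a /sD Da ->].
exists (restr_dual Y g), (restr_dual Y h), (Sub x (DY x Dx)); split=> //.
- by split; apply: IHf.
- by move=> a as_; apply/gf/map_f.
- by move=> a as_; apply/hf/map_f.
Qed.

(** * The countable hull of points and functionals *)

(* Elements [(x, (g, h))] of the hull carry a point [x] and two functionals. A
   step [inl q] forms a rational combination of points. A step
   [inr (k, j, m, b)] splits one of the two functionals of [u] into [g] and [h],
   which are close to it on the points of [A] and eps_j-separated at [x]. *)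
Definition szlenk_step (R : realType) (X : normedModType R) (eps : nat -> seq R)
    (i : rat + nat * nat * nat * bool) (s : seq (X * (dual X * dual X)))
    (w : X * (dual X * dual X)) : Prop :=
  match i, s with
  | inl q, [:: u; v] => w.1 = ratr q *: u.1 + v.1
  | inr (k, j, m, b), u :: A =>
    let f := if b then u.2.1 else u.2.2 in
    [/\ szlenk_derivs (drop j.+1 (eps k)) (dual_ball X) w.2.1 /\
        szlenk_derivs (drop j.+1 (eps k)) (dual_ball X) w.2.2,
      forall a, a \in A -> `|\val w.2.1 a.1 - \val f a.1| < m.+1%:R^-1,
      forall a, a \in A -> `|\val w.2.2 a.1 - \val f a.1| < m.+1%:R^-1,
      `|w.1| <= 1 &
      (eps k)`_j < `|\val w.2.1 w.1 - \val w.2.2 w.1|]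
  | _, _ => False
  end.

Lemma countable_szlenk_hull (R : realType) (X : normedModType R)
    (eps : nat -> seq R) (f0 : nat -> dual X) :
  exists (D : set X) (T : set (dual X)),
    [/\ countable D, D 0 /\
      (forall (q : rat) u v, D u -> D v -> D (ratr q *: u + v)),
      forall k, T (f0 k) &
      forall k j e l f (s : seq X) (d : R), drop j (eps k) = e :: l -> T f ->
        szlenk_derivs (e :: l) (dual_ball X) f -> (forall a, a \in s -> D a) ->
        0 < d -> exists (g h : dual X) (x : X),
        [/\ [/\ T g, T h & D x],
          szlenk_derivs l (dual_ball X) g /\ szlenk_derivs l (dual_ball X) h,
          forall a, a \in s -> `|\val g a - \val f a| < d,
          forall a, a \in s -> `|\val h a - \val f a| < d &
          `|x| <= 1 /\ e < `|\val g x - \val h x|]].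
Proof.
have [C cC [C0 CP]] := skolem_hull (@szlenk_step R X eps)
  (fun k => (0, (f0 k, f0 k))).
exists (fst @` C), [set f | exists2 w, C w & f = w.2.1 \/ f = w.2.2]; split.
- exact/(sub_countable (card_image_le _ _)).
- split=> [|q _ _ [u Cu <-] [v Cv <-]]; first by exists (0, (f0 0%N, f0 0%N)).
  have [w||w Cw /= wE] := CP (inl q) [:: u; v].
  + by rewrite !inE => /orP[]/eqP->.
  + by exists (ratr q *: u.1 + v.1, u.2).
  + by exists w.
- by move=> k; exists (0, (f0 k, f0 k)) => //; left.
move=> k j e l f s d drp [u Cu fu] Kf sD d0.
(* Steps only know the tolerances [1 / (m + 1)], which keeps them countable; one below [d] is
   used. *)
have [m] := ltr_add_invr d0; rewrite add0r => md.
have jk : (j < size (eps k))%N.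
  by rewrite ltnNge; apply/negP => /drop_oversize; rewrite drp.
have [ej lj] : e = (eps k)`_j /\ l = drop j.+1 (eps k).
  by move: drp; rewrite (drop_nth 0 jk) => -[-> ->].
have [b fb] : exists b : bool, f = if b then u.2.1 else u.2.2.
  by case: fu => ->; [exists true|exists false].
have [A AC As] : exists2 A, forall a, a \in A -> C a & map fst A = s.
  elim: s sD => [|x s IHs] sD; first by exists [::].
  have [a Ca ax] := sD x (mem_head _ _).
  have [|A AC As] := IHs; first by move=> y ys; apply: sD; rewrite inE ys orbT.
  exists (a :: A); last by rewrite /= ax As.
  by move=> y; rewrite inE => /orP[/eqP->|/AC].
have m0 : 0 < m.+1%:R^-1 :> R by rewrite invr_gt0 ltr0n.
(* This witness from all of [X] only shows that the step is solvable; the hull then supplies its own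
   solution [w]. *)
have [g [h [x [Kgh gf hf x1 ex]]]] := szlenk_deriv_witness s m0 Kf.
have [w||w Cw /=] := CP (inr (k, j, m, b)) (u :: A).
- by rewrite inE => /orP[/eqP->|/AC].
- exists (x, (g, h)) => /=; rewrite -ej -lj -fb; split=> // a aA.
    by apply: gf; rewrite -As map_f.
  by apply: hf; rewrite -As map_f.
rewrite -ej -lj -fb => -[wK w1 w2 wx ew].
exists w.2.1, w.2.2, w.1; split=> //.
- split; [by exists w => //; left|by exists w => //; right|by exists w].
- by move=> z; rewrite -As => /mapP[a aA ->]; exact: lt_trans (w1 a aA) md.
- by move=> z; rewrite -As => /mapP[a aA ->]; exact: lt_trans (w2 a aA) md.
Qed.

Theorem proposition11 (R : realType) (X : completeNormedModType R)
    (subX : forall Y : submodClosed X,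
      closed [set x : X | x \in Y] -> separable (submodule Y) ->
      summable_szlenk (submodule Y)) :
  summable_szlenk X.
Proof.
apply: contrapT => nX.
have /choice[p pP] (k : nat) : exists p : seq R * dual X,
    [/\ forall e, e \in p.1 -> 0 < e, szlenk_derivs p.1 (dual_ball X) p.2 &
        k%:R < \sum_(e <- p.1) e].
  apply: contrapT => np; apply: nX; exists k%:R => n eps eps0 [f Kf].
  rewrite leNgt; apply/negP => kM; apply: np; exists (tval eps, f); split=> //=.
    by move=> e /tnthP[i ->].
  by rewrite big_tuple.
(* The bound [M] below depends on [Y], so the hull must serve the tuples for all [k] at once. *)
have [D [T [cD [D0 Dlin] Tf0 wit]]] :=
  countable_szlenk_hull (fun k => (p k).1) (fun k => (p k).2).
have [Y YE] := closure_submodClosed D0 Dlin.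
have YD x : x \in Y -> closure D x by rewrite YE => /asboolP.
have DY x : D x -> x \in Y.
  by move=> Dx; rewrite YE; apply/asboolP; exact: subset_closure.
have [|M MP] := subX Y _ (submodule_separable cD YD DY).
  rewrite (_ : [set x | _] = closure D); first exact: closed_closure.
  by apply/seteqP; split=> x /=; rewrite YE => /asboolP.
(* Here [k > M], so the sum of the [k]-th tuple exceeds [M]. *)
pose k := (Num.truncn M).+1; have [pos Kp sp] := pP k.
have : \sum_(e <- (p k).1) e <= M.
  rewrite big_tnth; apply: (MP _ (in_tuple (p k).1)).
    by move=> i; apply: pos; apply: mem_tnth.
  exists (restr_dual Y (p k).2).
  apply: (restr_szlenk_derivs (D := D) (T := T)
    (S := [set l | exists k j, l = drop j (p k).1])) => //.
  - move=> e l [k' [j elE]]; exists k', j.+1.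
    by rewrite -addn1 addnC -drop_drop -elE /= drop0.
  - by move=> e l f s d [k' [j elE]] *; apply: (wit k' j).
  - by exists k, 0%N; rewrite drop0.
by move=> /(lt_le_trans sp)/(lt_trans (truncnS_gt M)); rewrite ltxx.
Qed.
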